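(* (Convolutional self-similarity of the little $q$-Jacobi measure.) Let $0<q<1$, $0<a_1<1$, $0<b_1<1$, $b_2<1$. Then for all integers $x\ge0$, $$\sum_{z=0}^x\pi(x-z,a_1,b_1)\,\pi(z,a_1b_1,b_2)=\pi(x,a_1,b_1b_2),$$ and for all integers $0\le y\le x$, $$\sum_{z=y}^x\pi(x-z,a_1,b_1)\,\pi(z-y,a_1b_1,b_2)=\pi(x-y,a_1,b_1b_2).$$
   Context: $(a;q)_n=\prod_{i=0}^{n-1}(1-aq^i)$, $(a;q)_\infty=\prod_{i\ge0}(1-aq^i)$. The little $q$-Jacobi measure with parameters $0<a<1$, $b<1$ is, for $x\in\mathbb Z_{\ge0}$, $\pi(x,a,b)=\frac{(b;q)_x\,a^x}{(q;q)_x}\frac{(a;q)_\infty}{(ab;q)_\infty}$. *)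

(* Defs.v *)
From HB Require Import structures.
From mathcomp Require Import all_boot all_order all_algebra.
From mathcomp Require Import all_classical all_reals all_analysis.

Set Implicit Arguments.
Unset Strict Implicit.
Unset Printing Implicit Defensive.

Import Order.TTheory GRing.Theory Num.Theory.
Import numFieldNormedType.Exports.

Local Open Scope classical_set_scope.
Local Open Scope ring_scope.

Definition qpoch (R : realType) (a q : R) (n : nat) : R :=
  \prod_(i < n) (1 - a * q ^+ i).

(* The partial products converge for |q| < 1; where they diverge, the value of
   [limn] carries no meaning. *)
Definition qpoch_inf (R : realType) (a q : R) : R :=
  limn (fun n : nat => qpoch a q n).

(* The mass pi(x, a, b) at x, with the base q explicit; it is meant for
   0 < q < 1, 0 < a < 1 and b < 1. *)
Definition little_qJacobi (R : realType) (q : R) (x : nat) (a b : R) : R :=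
  (qpoch b q x * a ^+ x) / qpoch q q x * (qpoch_inf a q / qpoch_inf (a * b) q).

(* Main.v *)
(** Up to the factor [a1 ^+ x] and the normalizing constants, the first identity
    is the q-Chu-Vandermonde sum
    [\sum_k A_(n-k)(b) b^k A_k(c) = A_n(b c)], where [A_n(b) = (b;q)_n / (q;q)_n].
    Both sides satisfy the recurrence
    [(1 - q^(n+1)) S_(n+1) = (1 - b c q^n) S_n]: for the left one, split
    [1 - q^(n+1) = (1 - q^(n+1-k)) + q^(n+1-k) (1 - q^k)].
    The constants telescope because [(a1 b1; q)_oo] does not vanish. *)
Require Import Defs.
From mathcomp Require Import all_boot all_order all_algebra.
From mathcomp Require Import all_classical all_reals all_analysis.
From mathcomp Require Import ring.

Import Order.TTheory GRing.Theory Num.Theory.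
Import numFieldNormedType.Exports.

Local Open Scope ring_scope.

Section QPochhammer.
Variables (R : realType) (q : R).
Hypotheses (q0 : 0 < q) (q1 : q < 1).

Lemma qpoch0 (b : R) : qpoch b q 0 = 1.
Proof. by rewrite /qpoch big_ord0. Qed.

Lemma qpochS (b : R) n : qpoch b q n.+1 = qpoch b q n * (1 - b * q ^+ n).
Proof. by rewrite /qpoch big_ord_recr. Qed.

Lemma qpoch_factor_gt0 (c : R) n : 0 <= c -> c < 1 -> 0 < 1 - c * q ^+ n.
Proof.
move=> c0 c1; rewrite subr_gt0 (le_lt_trans _ c1)//.
by rewrite ler_piMr// exprn_ile1// ltW.
Qed.

Lemma qpoch_gt0 (c : R) n : 0 <= c -> c < 1 -> 0 < qpoch c q n.
Proof. by move=> c0 c1; apply: prodr_gt0 => i _; exact: qpoch_factor_gt0. Qed.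

(** After inversion this follows from [expR_ge1Dx], as [1 + c / (1 - c) * t] is at least
    [(1 - c * t)^-1]. The exponent is linear in [t], so for [t = q ^+ i] the exponents add up to a
    geometric sum. *)
Lemma onem_ge_expR (c t : R) : 0 <= c -> c < 1 -> 0 <= t -> t <= 1 ->
  expR (- (c / (1 - c) * t)) <= 1 - c * t.
Proof.
move=> c0 c1 t0 t1.
have d0 : 0 < 1 - c by rewrite subr_gt0.
have ct : 0 < 1 - c * t by rewrite subr_gt0 (le_lt_trans _ c1)// ler_piMr.
rewrite expRN -[leRHS]invrK lef_pV2 ?posrE ?expR_gt0 ?invr_gt0//.
apply: le_trans (expR_ge1Dx _).
rewrite -subr_ge0.
have -> : 1 + c / (1 - c) * t - (1 - c * t)^-1 =
    c ^+ 2 * t * (1 - t) / ((1 - c) * (1 - c * t)).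
  by field; rewrite (gt_eqF ct) (gt_eqF d0).
have t1_ge0 : 0 <= 1 - t by rewrite subr_ge0.
by rewrite divr_ge0// ?mulr_ge0// ?sqr_ge0// ltW.
Qed.

Lemma qpoch_ge (c : R) n : 0 <= c -> c < 1 ->
  expR (- (c / (1 - c) / (1 - q))) <= qpoch c q n.
Proof.
move=> c0 c1.
have d0 : 0 < 1 - c by rewrite subr_gt0.
have e0 : 0 < 1 - q by rewrite subr_gt0.
(* The induction needs the exact partial geometric sum, not its bound [1 / (1 - q)]. *)
apply: (@le_trans _ _ (expR (- (c / (1 - c) * ((1 - q ^+ n) / (1 - q)))))).
  rewrite ler_expR lerN2 ler_wpM2l ?divr_ge0 ?(ltW d0)//.
  by rewrite ler_piMl ?invr_ge0 ?(ltW e0)// gerBl exprn_ge0// ltW.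
elim: n => [|n IHn]; first by rewrite qpoch0 subrr mul0r mulr0 oppr0 expR0.
have -> : (1 - q ^+ n.+1) / (1 - q) = (1 - q ^+ n) / (1 - q) + q ^+ n.
  by rewrite exprS; field; rewrite gt_eqF.
rewrite qpochS mulrDr opprD expRD ler_pM ?expR_ge0//.
by apply: onem_ge_expR; rewrite ?exprn_ge0 ?exprn_ile1// ltW.
Qed.

(** Positive partial products could still tend to 0; the lower bound of [qpoch_ge], uniform in [n],
    excludes this and, with monotonicity, yields convergence. *)
Lemma qpoch_inf_gt0 (c : R) : 0 <= c -> c < 1 -> 0 < qpoch_inf c q.
Proof.
move=> c0 c1; apply: lt_le_trans (expR_gt0 _) _.
have lb n := @qpoch_ge c n c0 c1.
apply: limr_ge; last by apply: nearW => n; exact: lb.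
apply: nonincreasing_is_cvgn; last first.
  by eexists => _ [n _ <-]; exact: lb.
apply/nonincreasing_seqP => n; rewrite qpochS.
rewrite ler_piMr//; first exact/ltW/qpoch_gt0.
by rewrite gerBl mulr_ge0// exprn_ge0// ltW.
Qed.

Lemma qpoch_ratioS (b : R) n :
  (1 - q ^+ n.+1) * (qpoch b q n.+1 / qpoch q q n.+1) =
  (1 - b * q ^+ n) * (qpoch b q n / qpoch q q n).
Proof.
rewrite !qpochS -exprS; field.
rewrite !gt_eqF ?qpoch_gt0// 1?ltW//.
by rewrite exprS qpoch_factor_gt0// ltW.
Qed.

Lemma q_Vandermonde (b c : R) n :
  \sum_(k < n.+1) qpoch b q (n - k) / qpoch q q (n - k) * b ^+ k *
    (qpoch c q k / qpoch q q k) = qpoch (b * c) q n / qpoch q q n.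
Proof.
elim: n => [|n IHn].
  by rewrite big_ord1 /= subnn !qpoch0 expr0 invr1 !mulr1.
have qn0 : 1 - q ^+ n.+1 != 0 by rewrite exprS gt_eqF ?qpoch_factor_gt0// ltW.
apply: (mulfI qn0); rewrite qpoch_ratioS -IHn !mulr_sumr.
pose A b k := qpoch b q k / qpoch q q k.
transitivity (\sum_(k < n.+2)
   ((1 - q ^+ (n.+1 - k)) * A b (n.+1 - k)%N * b ^+ k * A c k +
    q ^+ (n.+1 - k) * A b (n.+1 - k)%N * b ^+ k * ((1 - q ^+ k) * A c k))).
  apply: eq_bigr => k _; rewrite -/(A b _) -/(A c _).
  have -> : q ^+ n.+1 = q ^+ (n.+1 - k) * q ^+ k.
    by rewrite -exprD subnK// -ltnS.
  by ring.
(* The first half vanishes at [k = n.+1] and the second at [k = 0]; shifting the latter makes both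
   sums run over [k <= n]. *)
rewrite big_split /= big_ord_recr /= subnn expr0 subrr !mul0r addr0.
rewrite [X in _ + X]big_ord_recl /= expr0 subrr mul0r mulr0 add0r -big_split /=.
apply: eq_bigr => k _; rewrite /bump leq0n add1n subSS.
have kn : (k <= n)%N by rewrite -ltnS.
rewrite subSn// /A !qpoch_ratioS -/(A b _) -/(A c _).
have -> : q ^+ n = q ^+ (n - k) * q ^+ k by rewrite -exprD subnK.
(* The coefficients combine: [(1 - b q^(n-k)) + b q^(n-k) (1 - c q^k) = 1 - b c q^n]. *)
by rewrite exprS; ring.
Qed.

Lemma little_qJacobi_convolution (a b c : R) x : 0 <= a * b -> a * b < 1 ->
  \sum_(0 <= z < x.+1)
    little_qJacobi q (x - z)%N a b * little_qJacobi q z (a * b) c =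
  little_qJacobi q x a (b * c).
Proof.
move=> ab0 ab1.
have P0 : qpoch_inf (a * b) q != 0 by rewrite gt_eqF ?qpoch_inf_gt0.
rewrite big_mkord /little_qJacobi [a * (b * c)]mulrA.
rewrite [qpoch (b * c) q x * _ / _]mulrAC -q_Vandermonde !mulr_suml.
apply: eq_bigr => k _.
have -> : a ^+ x = a ^+ (x - k) * a ^+ k by rewrite -exprD subnK// -ltnS.
(* Inserts [(a b; q)_oo] above and below, matching the two constants on the left. *)
rewrite exprMn -[qpoch_inf a q / qpoch_inf (a * b * c) q](divfK P0).
by ring.
Qed.

End QPochhammer.

Theorem mainTheorem20 (R : realType) (q a1 b1 b2 : R)
  (hq0 : 0 < q) (hq1 : q < 1)
  (ha0 : 0 < a1) (ha1 : a1 < 1)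
  (hb0 : 0 < b1) (hb1 : b1 < 1)
  (hb2 : b2 < 1) :
  (forall x : nat,
     \sum_(0 <= z < x.+1)
        little_qJacobi q (x - z)%N a1 b1 * little_qJacobi q z (a1 * b1) b2
     = little_qJacobi q x a1 (b1 * b2)) /\
  (forall x y : nat, (y <= x)%N ->
     \sum_(y <= z < x.+1)
        little_qJacobi q (x - z)%N a1 b1
        * little_qJacobi q (z - y)%N (a1 * b1) b2
     = little_qJacobi q (x - y)%N a1 (b1 * b2)).
Proof.
have ab0 : 0 <= a1 * b1 by rewrite mulr_ge0 ?ltW.
have ab1 : a1 * b1 < 1 by rewrite mulr_ilt1// ltW.
split=> [x|x y yx]; first exact: little_qJacobi_convolution.
(* The shift [z -> z + y] turns this into the first identity at [x - y]. *)
rewrite -little_qJacobi_convolution// -{1}[y]add0n big_addn subSn//.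
by apply: eq_bigr => z _; rewrite addnK addnC subnDA.
Qed.
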